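(* If $\mu\in\mathcal M_m$ is $F$-invariant, then $\mu(J_r(F))=1$.
   Context: Setting. $(\Omega,\mathcal F,m)$ is a complete probability space; $\theta:\Omega\to\Omega$ is an invertible measurable map with measurable inverse, preserving $m$ and ergodic with respect to $m$. Real constants $B>A>1/e$ are fixed, and $\eta:\Omega\to[A,B]$ is measurable. For $\omega\in\Omega$ put $f_\omega(z)=\eta(\omega)e^z$, $f_\omega:\mathbb C\to\mathbb C$. Let $Q=\mathbb C/2\pi i\mathbb Z$ be the cylinder with quotient map $\pi:\mathbb C\to Q$ and the quotient Euclidean metric; for $z\in Q$, $|z|:=\inf\{|Z|:Z\in\pi^{-1}(z)\}$. Since $f_\omega$ is $2\pi i$-periodic, $\pi\circ f_\omega$ descends to a holomorphic map $F_\omega:Q\to Q$. Put $F_\omega^n:=F_{\theta^{n-1}\omega}\circ\cdots\circ F_{\theta\omega}\circ F_\omega$ and $F(\omega,z)=(\theta\omega,F_\omega(z))$ on $\Omega\times Q$. Random measures. $\mathcal M_m$ is the set of probability measures on $\Omega\times Q$ (with the product of $\mathcal F$ and the Borel $\sigma$-algebra of $Q$) whose projection to $\Omega$ is $m$. $\mu\in\mathcal M_m$ is $F$-invariant if $\mu\circ F^{-1}=\mu$. Radial Julia sets. For $\omega\in\Omega$, $z\in Q$ and an integer $N\ge1$, $N_\omega(z,N)$ is the set of all integers $n\ge0$ such that $|F_\omega^n(z)|\le N$ and there exists a holomorphic inverse branch $F_{\omega,z}^{-n}:B(F_\omega^n(z),2/N)\to Q$ of $F_\omega^n$ sending $F_\omega^n(z)$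 to $z$. For $S\subset\mathbb N$, $\underline\rho(S)=\liminf_{k\to\infty}\frac1k\#(S\cap\{1,\dots,k\})$ is its lower density. Then $J_r(\omega):=\{z\in Q:\lim_{N\to\infty}\underline\rho(N_\omega(z,N))=1\}$ and $J_r(F):=\bigcup_{\omega\in\Omega}\{\omega\}\times J_r(\omega)$. *)

(* Defs.v *)
(* The reals are an arbitrary [R : realType] and the complex plane is [R[i]]. *)
From HB Require Import structures.
From mathcomp Require Import all_boot all_order all_algebra.
From mathcomp Require Import generic_quotient complex.
From mathcomp Require Import all_classical all_reals all_analysis.

Set Implicit Arguments.
Unset Strict Implicit.
Unset Printing Implicit Defensive.

Import Order.TTheory GRing.Theory Num.Theory numFieldNormedType.Exports.

Local Open Scope classical_set_scope.
Local Open Scope ring_scope.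
Local Open Scope complex_scope.

Definition expC (R : realType) (z : R[i]) : R[i] :=
  (expR (complex.Re z) * cos (complex.Im z)) +i* (expR (complex.Re z) * sin (complex.Im z)).

Section cylinder.
Local Open Scope quotient_scope.
Variable R : realType.
Local Notation C := R[i].
Local Notation normc := (@Normc.normc R).

Definition cyl_period (k : int) : C := 0 +i* ((pi *+ 2) *~ k).

Definition cyl_rel : rel C := fun Z W => `[< exists k : int, Z - W = cyl_period k >].

Let cyl_period0 : cyl_period 0 = 0.
Proof. by rewrite /cyl_period mulr0z. Qed.

Let cyl_periodN k : cyl_period (- k) = - cyl_period k.
Proof. by apply/eqP; rewrite eq_complex /= oppr0 eqxx mulrNz eqxx. Qed.

Let cyl_periodD k l : cyl_period (k + l) = cyl_period k + cyl_period l.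
Proof. by apply/eqP; rewrite eq_complex /= addr0 eqxx mulrzDr eqxx. Qed.

Let cyl_rel_refl : reflexive cyl_rel.
Proof. by move=> Z; apply/asboolP; exists 0; rewrite subrr cyl_period0. Qed.

Let cyl_rel_sym : symmetric cyl_rel.
Proof.
suff H Z W : cyl_rel Z W -> cyl_rel W Z by move=> Z W; apply/idP/idP; exact: H.
move=> /asboolP[k ZW]; apply/asboolP; exists (- k).
by rewrite cyl_periodN -ZW opprB.
Qed.

Let cyl_rel_trans : transitive cyl_rel.
Proof.
move=> W Z V /asboolP[k ZW] /asboolP[l WV]; apply/asboolP; exists (k + l).
by rewrite cyl_periodD -ZW -WV addrA subrK.
Qed.

Definition cyl_equiv := EquivRel cyl_rel cyl_rel_refl cyl_rel_sym cyl_rel_trans.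

(* The quotient of C by the translations by multiples of 2 pi i. *)
Definition cylinder : Type := {eq_quot cyl_equiv}.

HB.instance Definition _ := Choice.on cylinder.

Definition cyl_pi (Z : C) : cylinder := \pi_({eq_quot cyl_equiv}) Z.

Definition cyl_repr (p : cylinder) : C := repr (p : {eq_quot cyl_equiv}).

Lemma cyl_reprK p : cyl_pi (cyl_repr p) = p.
Proof. exact: reprK. Qed.

Lemma cyl_piP Z W : cyl_pi Z = cyl_pi W <-> exists k : int, Z - W = cyl_period k.
Proof.
split; first by move=> /eqmodP /asboolP.
by move=> ZW; apply/eqmodP/asboolP.
Qed.

Definition cyl_norm (p : cylinder) : R := inf [set normc Z | Z in cyl_pi @^-1` [set p]].

Definition cyl_dist (p q : cylinder) : R :=
  inf [set normc (ZW.1 - ZW.2) | ZW in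
         (cyl_pi @^-1` [set p]) `*` (cyl_pi @^-1` [set q])].

Let normc_ge0 (Z : C) : 0 <= normc Z.
Proof. by rewrite /Normc.normc; case: Z => a b; exact: sqrtr_ge0. Qed.

Let normcN (Z : C) : normc (- Z) = normc Z.
Proof. by case: Z => a b; rewrite /Normc.normc /= !sqrrN. Qed.

Let normcD (Z W : C) : normc (Z + W) <= normc Z + normc W.
Proof. exact: le_normcD. Qed.

Let Im_le_normc (Z : C) : `|complex.Im Z| <= normc Z.
Proof.
case: Z => a b; rewrite /Normc.normc /= -sqrtr_sqr.
by rewrite ler_wsqrtr// lerDr sqr_ge0.
Qed.

Let dset p q := [set normc (ZW.1 - ZW.2) | ZW in
         (cyl_pi @^-1` [set p]) `*` (cyl_pi @^-1` [set q])].

Let dset_inf p q : has_inf (dset p q).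
Proof.
split.
  exists (normc (cyl_repr p - cyl_repr q)), (cyl_repr p, cyl_repr q) => //.
  by split; exact: cyl_reprK.
by exists 0 => _ [ZW _ <-].
Qed.

Let cyl_dist_le Z W : cyl_dist (cyl_pi Z) (cyl_pi W) <= normc (Z - W).
Proof.
by apply: ge_inf; [exact: (dset_inf _ _).2|exists (Z, W)].
Qed.

Let cyl_dist_ge0 p q : 0 <= cyl_dist p q.
Proof. by apply: lb_le_inf; [exact: (dset_inf _ _).1|move=> _ [ZW _ <-]]. Qed.

Let cyl_dist_lt Z q e : cyl_dist (cyl_pi Z) q < e ->
  exists2 W, cyl_pi W = q & normc (Z - W) < e.
Proof.
move=> /(inf_lt (dset_inf _ _).1)[_ [[Z' W'] /= [Z'Z W'q]] <- lt_e].
have /cyl_piP[k Zk] : cyl_pi Z = cyl_pi Z' by rewrite Z'Z.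
exists (W' + cyl_period k).
  by rewrite -W'q; apply/cyl_piP; exists k; rewrite addrC addKr.
by rewrite -Zk opprD opprB addrCA [Z + (_ - Z)]addrC subrK addrC.
Qed.

Let cyl_distxx p : cyl_dist p p = 0.
Proof.
apply/eqP; rewrite eq_le cyl_dist_ge0 andbT.
have := cyl_dist_le (cyl_repr p) (cyl_repr p).
by rewrite cyl_reprK subrr Normc.normc0.
Qed.

Let cyl_dist_positivity p q : cyl_dist p q = 0 -> p = q.
Proof.
rewrite -(cyl_reprK p); set Z := cyl_repr p => d0.
have pi0 : 0 < pi :> R by exact: pi_gt0.
have [W Wq ZW] : exists2 W, cyl_pi W = q & normc (Z - W) < pi.
  by apply: cyl_dist_lt; rewrite d0.
rewrite -Wq; congr cyl_pi; apply/eqP; rewrite -subr_eq0; apply/eqP.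
apply: Normc.eq0_normc; apply/eqP; rewrite eq_le normc_ge0 andbT.
rewrite leNgt; apply/negP => ZW0.
have [V Vq ZV] : exists2 V, cyl_pi V = q & normc (Z - V) < normc (Z - W).
  by apply: cyl_dist_lt; rewrite d0.
have /cyl_piP[k Vk] : cyl_pi V = cyl_pi W by rewrite Vq.
have : normc (V - W) < pi *+ 2.
  rewrite -[V - W](subrKA Z) addrC.
  rewrite (le_lt_trans (normcD _ _))// -[V - Z]opprB normcN mulr2n ltrD//.
  exact: lt_trans ZW.
rewrite Vk; have [k0|k0] := eqVneq k 0.
  move: Vk ZV; rewrite k0 cyl_period0 => /eqP; rewrite subr_eq0 => /eqP ->.
  by rewrite ltxx.
have tau0 : 0 < pi *+ 2 :> R by rewrite pmulrn_rgt0.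
move=> /(le_lt_trans (Im_le_normc _)) /=.
rewrite normrMz (gtr0_norm tau0) -mulrzr -[X in _ < X]mulr1 ltr_pM2l//.
move=> k1; have {k1} : (`|k|%N%:Z%:~R : R) < 1 by exact: k1.
rewrite ltrz1.
by case: k k0 {Vk} => [[|n]|n].
Qed.

Let cyl_dist_sym p q : cyl_dist p q = cyl_dist q p.
Proof.
rewrite /cyl_dist; congr inf; apply/seteqP.
by split => _ [[Z W] /= [Zp Wq] <-]; exists (W, Z) => //=; rewrite -opprB normcN.
Qed.

Let cyl_dist_triangle q p r : cyl_dist p r <= cyl_dist p q + cyl_dist q r.
Proof.
apply/ler_addgt0Pr => e e0.
have e20 : 0 < e / 2 by rewrite divr_gt0.
have [W Wq pW] : exists2 W, cyl_pi W = q &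
    normc (cyl_repr p - W) < cyl_dist p q + e / 2.
  by apply: cyl_dist_lt; rewrite cyl_reprK ltrDl.
have [V Vr WV] : exists2 V, cyl_pi V = r & normc (W - V) < cyl_dist q r + e / 2.
  by apply: cyl_dist_lt; rewrite Wq ltrDl.
have := cyl_dist_le (cyl_repr p) V; rewrite cyl_reprK Vr => /le_trans; apply.
rewrite -(subrKA W) (le_trans (normcD _ _))// [e in leRHS]splitr addrACA.
by apply/ltW; exact: ltrD.
Qed.

HB.instance Definition _ := @isMetric.Build R cylinder cyl_dist
  cyl_distxx cyl_dist_positivity cyl_dist_sym cyl_dist_triangle.

HB.instance Definition _ := isPointed.Build cylinder (cyl_pi 0).

Definition cyl_borel : set (set cylinder) := <<s [set U : set cylinder | open U] >>.

HB.instance Definition _ := @isMeasurable.Build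
  (sigma_display [set U : set cylinder | open U]) cylinder cyl_borel
  (@sigma_algebra0 _ setT _) (@sigma_algebraC _ _) (@sigma_algebra_bigcup _ setT _).

End cylinder.

(* Holomorphy in the charts of the cylinder given by the local inverses of the
   projection: near every lift of a point of [U], [g] lifts to a complex
   differentiable map.  [R[i]^o] carries the topology of C. *)
Definition cyl_holomorphic (R : realType) (U : set (cylinder R))
    (g : cylinder R -> cylinder R) : Prop :=
  forall Z : R[i]^o, U (cyl_pi Z) ->
    exists G : R[i]^o -> R[i]^o,
      (\forall W \near Z, derivable G W 1) /\
      (\forall W \near Z, g (cyl_pi W) = cyl_pi (G W)).

Definition exp_map (R : realType) (a : R) (z : R[i]) : R[i] := a%:C * expC z.

(* [cyl_map_pi] below: the map does not depend on the chosen lift. *)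
Definition cyl_map (R : realType) (a : R) (p : cylinder R) : cylinder R :=
  cyl_pi (exp_map a (cyl_repr p)).

Lemma exp_map_periodic (R : realType) (a : R) (Z W : R[i]) :
  cyl_pi Z = cyl_pi W -> exp_map a Z = exp_map a W.
Proof.
move=> /cyl_piP[k ZWk]; have -> : Z = W + cyl_period R k by rewrite -ZWk addrC subrK.
have trig (f : R -> R) : (forall x, f (x + pi *+ 2) = f x) ->
    forall x, f (x + (pi *+ 2) *~ k) = f x.
  move=> fper; have fpern n x : f (x + (pi *+ 2) *+ n) = f x.
    by elim: n => [|n IHn] in x *; rewrite ?mulr0n ?addr0// mulrS addrA IHn.
  case: k {ZWk} => n x; first by rewrite -pmulrn fpern.
  by rewrite NegzE mulrNz -pmulrn -[LHS](fpern n.+1) subrK.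
case: W {ZWk} => x y; rewrite /exp_map /expC /= addr0.
by rewrite !trig// => u; [exact: sinD2pi|exact: cosD2pi].
Qed.

Lemma cyl_map_pi (R : realType) (a : R) (Z : R[i]) :
  cyl_map a (cyl_pi Z) = cyl_pi (exp_map a Z).
Proof.
by rewrite /cyl_map; congr cyl_pi; apply: exp_map_periodic; rewrite cyl_reprK.
Qed.

Definition lower_density (R : realType) (S : set nat) : R :=
  limn_inf (fun k : nat => k%:R^-1 * (\sum_(1 <= i < k.+1) `[< S i >])%:R : R).

Section random_dynamics.
Variables (R : realType) (d : measure_display) (Omega : measurableType d).
Variables (theta : Omega -> Omega) (eta : Omega -> R).

Definition fiber_map (omega : Omega) : cylinder R -> cylinder R :=
  cyl_map (eta omega).

Fixpoint fiber_iter (n : nat) (omega : Omega) (z : cylinder R) : cylinder R :=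
  if n is n'.+1 then fiber_map (iter n' theta omega) (fiber_iter n' omega z)
  else z.

Definition skew_map (x : Omega * cylinder R) : Omega * cylinder R :=
  (theta x.1, fiber_map x.1 x.2).

(* [g] is a total map, but only its values on the ball matter. *)
Definition inverse_branch (n : nat) (omega : Omega) (z : cylinder R) (r : R)
    (g : cylinder R -> cylinder R) : Prop :=
  let B := ball (fiber_iter n omega z) r in
  [/\ cyl_holomorphic B g,
      (forall w, B w -> fiber_iter n omega (g w) = w) &
      g (fiber_iter n omega z) = z].

Definition good_times (omega : Omega) (z : cylinder R) (N : nat) : set nat :=
  [set n | cyl_norm (fiber_iter n omega z) <= N%:R /\
           exists g, inverse_branch n omega z (2 / N%:R) g].

Definition radial_julia_fiber (omega : Omega) : set (cylinder R) :=
  [set z | (fun N : nat => lower_density R (good_times omega z N)) @ \oo --> (1 : R)].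

Definition radial_julia : set (Omega * cylinder R) :=
  [set x | radial_julia_fiber x.1 x.2].

End random_dynamics.

Definition measure_preserving (R : realType) (d : measure_display)
    (T : measurableType d) (mu : set T -> \bar R) (f : T -> T) : Prop :=
  forall A, measurable A -> pushforward mu f A = mu A.

Definition ergodic (R : realType) (d : measure_display)
    (T : measurableType d) (mu : set T -> \bar R) (f : T -> T) : Prop :=
  forall A, measurable A -> f @^-1` A = A -> mu A = 0%E \/ mu A = 1%E.

(* Main.v *)
(* On the cylinder only the real part [x] can be large, and a point lies in the
   radial Julia set if and only if its orbit satisfies [|x| <= N] with lower
   density tending to 1 as [N] grows.  Indeed all singular values of the iterates
   lie on the real line, so inverse branches exist on every disc avoiding it
   (iterate a branch of the logarithm on the half-planes).  Since [A > 1/e], every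
   real orbit escapes to infinity at a definite speed, so an orbit which comes very
   close to the real line within [|x| <= N] leaves [|x| <= N] after a fixed number
   [K] of steps.  Hence the times [n] with [|x_n| <= N] and [|x_(n+K)| <= N] are
   good times for some larger [N'], and the upper density of the other times is at
   most twice that of the times with [|x_n| > N].
   This description is visibly measurable.  It holds almost surely for an invariant
   probability: the set [|x| > N] has small measure, so by the maximal ergodic
   inequality it is visited with small frequency off a set of small measure. *)
Require Import Defs.
From HB Require Import structures.
From mathcomp Require Import all_boot all_order all_algebra.
From mathcomp Require Import complex.
From mathcomp Require Import all_classical all_reals all_analysis.
From mathcomp Require Import measurable_realfun zify ring lra.

Set Implicit Arguments.
Unset Strict Implicit.
Unset Printing Implicit Defensive.

Import Order.TTheory GRing.Theory Num.Theory numFieldNormedType.Exports.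

Local Open Scope classical_set_scope.
Local Open Scope ring_scope.

(** * The complex exponential and a logarithm off the real axis *)

Section complex_plane.
Local Open Scope complex_scope.
Variable R : realType.
Local Notation C := R[i].
Local Notation normc := (@Normc.normc R).
Local Notation Re := (@complex.Re R).
Local Notation Im := (@complex.Im R).

Lemma complexP (Z W : C) : Re Z = Re W -> Im Z = Im W -> Z = W.
Proof. by case: Z => a b; case: W => c d /= -> ->. Qed.

Lemma norm_normc (Z : C) : `|Z| = (normc Z)%:C.
Proof. by case: Z. Qed.

Lemma normc_ge0 (Z : C) : 0 <= normc Z.
Proof. by case: Z => a b; exact: sqrtr_ge0. Qed.

Lemma Re_le_normc (Z : C) : `|Re Z| <= normc Z.
Proof. by rewrite -lecR -norm_normc; exact: normc_ge_Re. Qed.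

Lemma Im_le_normc (Z : C) : `|Im Z| <= normc Z.
Proof.
by case: Z => a b; rewrite /= -sqrtr_sqr ler_wsqrtr// lerDr sqr_ge0.
Qed.

Lemma normc_le_ReIm (Z : C) : normc Z <= `|Re Z| + `|Im Z|.
Proof.
case: Z => a b /=.
rewrite -[leRHS]ger0_norm ?addr_ge0// -sqrtr_sqr ler_wsqrtr// sqrrD.
by rewrite !real_normK ?num_real// lerD2r lerDl mulrn_wge0// mulr_ge0.
Qed.

Lemma normc_distC (Z W : C) : normc (Z - W) = normc (W - Z).
Proof. by rewrite -normcN opprB. Qed.

(** Balls of [C^o] have radii in [C]. A positive complex number is real, so real radii generate the
    same neighbourhoods. *)
Lemma nbhs_complexP (Z : C^o) (P : set C^o) :
  nbhs Z P <-> exists2 e : R, 0 < e & forall W : C, normc (W - Z) < e -> P W.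
Proof.
split.
  move=> /nbhs_ballP[e /= e0 eP]; exists (Re e).
    by move: e0; rewrite ltcE => /andP[_].
  move=> W WZ; apply: eP; rewrite -ball_normE /= distrC norm_normc ltcE /= WZ andbT.
  by move: e0; rewrite ltcE => /andP[/eqP -> _].
move=> [e e0 eP]; apply/nbhs_ballP; exists e%:C; first by rewrite /= ltcR.
move=> W; rewrite -ball_normE /= distrC norm_normc ltcR; exact: eP.
Qed.

Lemma cvg_complexP (T : Type) (F : set_system T) {FF : Filter F}
    (f : T -> C^o) (l : C^o) :
  f x @[x --> F] --> l <->
  forall e : R, 0 < e -> \forall x \near F, normc (f x - l) < e.
Proof.
split=> [fl e e0|fl P /nbhs_complexP[e e0 eP]].
  apply: (fl [set W | normc (W - l) < e]).
  by apply/nbhs_complexP; exists e.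
by near=> x; apply: eP; near: x; exact: fl.
Unshelve. all: by end_near. Qed.

Lemma cvg_Complex (T : Type) (F : set_system T) {FF : Filter F}
    (f g : T -> R) (a b : R) :
  f x @[x --> F] --> a -> g x @[x --> F] --> b ->
  (f x +i* g x : C^o) @[x --> F] --> (a +i* b : C^o).
Proof.
move=> fa gb; apply/cvg_complexP => e e0.
have e20 : 0 < e / 2 by rewrite divr_gt0.
move/cvgrPdist_lt : fa => /(_ _ e20) fa; move/cvgrPdist_lt : gb => /(_ _ e20) gb.
near=> x.
rewrite (le_lt_trans (normc_le_ReIm _))//= (splitr e) ltrD// distrC; near: x.
  exact: fa.
exact: gb.
Unshelve. all: by end_near. Qed.

Lemma continuous_Re : continuous (Re : C^o -> R).
Proof.
move=> Z; apply/(@cvgrPdist_lt _ _ _ (nbhs (Z : C^o))) => e e0.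
apply/nbhs_complexP; exists e => // W WZ.
have -> : Re Z - Re W = Re (Z - W) by case: (Z) (W) => ? ? [].
by rewrite (le_lt_trans (Re_le_normc _))// normc_distC.
Qed.

Lemma continuous_Im : continuous (Im : C^o -> R).
Proof.
move=> Z; apply/(@cvgrPdist_lt _ _ _ (nbhs (Z : C^o))) => e e0.
apply/nbhs_complexP; exists e => // W WZ.
have -> : Im Z - Im W = Im (Z - W) by case: (Z) (W) => ? ? [].
by rewrite (le_lt_trans (Im_le_normc _))// normc_distC.
Qed.

Lemma continuous_normc : continuous (normc : C^o -> R).
Proof.
move=> Z; apply/(@cvgrPdist_lt _ _ _ (nbhs (Z : C^o))) => e e0.
apply/nbhs_complexP; exists e => // W WZ.
have H (U V : C) : normc U - normc V <= normc (U - V).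
  by rewrite lerBlDr (le_trans _ (le_normcD _ _))// subrK.
by apply: le_lt_trans WZ; rewrite ler_norml lerNl opprB H normc_distC H.
Qed.

(** * First-order expansion of the complex exponential at 0 *)

Lemma derive_littleo (f : R -> R) (l : R) (e : R) : is_derive (0 : R) (1 : R) f l ->
  0 < e -> \forall h \near (0 : R), `|f h - f 0 - l * h| <= e * `|h|.
Proof.
move=> [df <-] e0.
have /cvgrPdist_lt/(_ _ e0) := df; rewrite near_withinE => H.
near=> h.
have : h != 0 -> `|'D_1 f 0 - h^-1 *: (f (h *: (1:R) + 0) - f 0)| < e.
  by near: h; exact: H.
have [-> _|h0 /(_ isT)] := eqVneq h 0.
  by rewrite mulr0 subr0 subrr normr0 mulr0.
rewrite addr0 [h *: 1]mulr1 => /ltW.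
rewrite distrC -(ler_pM2r (_ : 0 < `|h|)) ?normr_gt0// -normrM mulrBl.
by rewrite [h^-1 *: _]mulrC mulfVK.
Unshelve. all: by end_near. Qed.

(** Combines the first-order expansions at 0 of the real exponential, sine and cosine; it supplies
    the derivative needed to differentiate [logC]. *)
Lemma expC_sub1 (e : R) : 0 < e -> exists2 r : R, 0 < r &
  forall k : C, normc k < r -> normc (expC k - 1 - k) <= e * normc k.
Proof.
(* The error terms [L1] to [L4] below add up to 2 + 1 + 2 + 1 sixths of [e]; each factor 2 is the
   bound on [expR]. *)
move=> e0; have e60 : 0 < e / 6 by rewrite divr_gt0.
have := derive_littleo (@is_derive_expR R 0) e60.
have := derive_littleo (@is_derive_sin R 0) e60.
have := derive_littleo (@is_derive_cos R 0) e60.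
have : \forall h \near (0 : R), expR h <= 2.
  have := @continuous_expR R 0; rewrite /continuous_at expR0.
  move=> /cvgr_le; apply; lra.
have : \forall h \near (0 : R), `|expR h - 1| <= e / 6.
  have := @continuous_expR R 0; rewrite /continuous_at expR0.
  by move=> /cvgr_distC_le; apply.
move=> H1 H2 H3 H4 H5.
have H := filterI H1 (filterI H2 (filterI H3 (filterI H4 H5))).
have [r /= r0 rP] := (nbhs_ballP _ _).1 (H _ _ _ _).
exists r => // -[a b] abr; set n := normc _ in abr *.
have an : `|a| <= n := Re_le_normc (a +i* b).
have bn : `|b| <= n := Im_le_normc (a +i* b).
have /= := rP a; rewrite -ball_normE /= sub0r normrN => /(_ (le_lt_trans an abr)).
move=> [Ha1 [Ha2 [_ [_ Ha5]]]].
have /= := rP b; rewrite -ball_normE /= sub0r normrN => /(_ (le_lt_trans bn abr)).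
move=> [_ [_ [Hb3 [Hb4 _]]]].
rewrite cos0 sin0 oppr0 mul0r subr0 in Hb3.
rewrite cos0 sin0 subr0 mul1r in Hb4.
rewrite expR0 mul1r in Ha5.
apply: (le_trans (normc_le_ReIm (expC (a +i* b) - 1 - (a +i* b)))) => /=.
have -> : expR a * cos b - 1 - a = expR a * (cos b - 1) + (expR a - 1 - a) by ring.
have -> : expR a * sin b - 0 - b = expR a * (sin b - b) + (expR a - 1) * b by ring.
have ea : 0 <= expR a := expR_ge0 a.
have L1 : `|expR a * (cos b - 1)| <= 2 * (e / 6 * n).
  rewrite normrM (ger0_norm ea) ler_pM//.
  by rewrite (le_trans Hb3)// ler_pM2l.
have L2 : `|expR a - 1 - a| <= e / 6 * n by rewrite (le_trans Ha5)// ler_pM2l.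
have L3 : `|expR a * (sin b - b)| <= 2 * (e / 6 * n).
  rewrite normrM (ger0_norm ea) ler_pM//.
  by rewrite (le_trans Hb4)// ler_pM2l.
have L4 : `|(expR a - 1) * b| <= e / 6 * n by rewrite normrM ler_pM.
have M1 := ler_normD (expR a * (cos b - 1)) (expR a - 1 - a).
have M2 := ler_normD (expR a * (sin b - b)) ((expR a - 1) * b).
lra.
Qed.

(* The argument is read off from the cotangent, so that it is continuous on each
   of the two half-planes; on the real axis the value is junk. *)
Definition logC (Z : C) : C :=
  ln (normc Z) +i* (Num.sg (Im Z) * (pi / 2) - atan (Re Z / Im Z)).

Lemma normc_gt0 (Z : C) : (0 < normc Z) = (Z != 0).
Proof.
rewrite lt_def normc_ge0 andbT; congr negb; apply/eqP/eqP => [|->].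
  exact: Normc.eq0_normc.
exact: Normc.normc0.
Qed.

Lemma sin_atan (x : R) : sin (atan x) = x / Num.sqrt (1 + x ^+ 2).
Proof.
have c0 : cos (atan x) != 0.
  by rewrite cos_atan invr_neq0// gt_eqF// sqrtr_gt0 ltr_pwDl// sqr_ge0.
by rewrite -cos_atan -[X in _ = X * _]atanK /tan mulfVK.
Qed.

(** Subtracting [atan (x / y)] from plus or minus [pi / 2] swaps its sine and cosine, and the sign
    of [y] turns them into [x / r] and [y / r]. *)
Lemma logCK (Z : C) : Im Z != 0 -> expC (logC Z) = Z.
Proof.
case: Z => x y /= y0; rewrite /expC /logC /=; set r := Num.sqrt _.
have sy0 : Num.sg y != 0 by rewrite sgr_eq0.
have r0 : 0 < r.
  rewrite sqrtr_gt0 ltr_wpDl// ?sqr_ge0// exprn_even_gt0//=.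
have E : Num.sqrt (1 + (x / y) ^+ 2) = r / `|y|.
  apply/eqP; rewrite -(@eqrXn2 _ 2)// ?sqrtr_ge0 ?divr_ge0 ?sqrtr_ge0//.
  rewrite sqr_sqrtr ?addr_ge0 ?sqr_ge0// !expr_div_n real_normK ?num_real//.
  by rewrite sqr_sqrtr ?addr_ge0 ?sqr_ge0// mulrDl divff ?sqrf_eq0// addrC.
have ny : `|y| != 0 by rewrite normr_eq0.
have sg2 : Num.sg y = 1 \/ Num.sg y = -1.
  by case: sgrP y0 => //; [left|right].
have cE : cos (Num.sg y * (pi / 2)) = 0.
  by case: sg2 => ->; rewrite ?mulN1r ?cosN ?mul1r cos_pihalf.
have sE : sin (Num.sg y * (pi / 2)) = Num.sg y.
  by case: sg2 => ->; rewrite ?mulN1r ?sinN ?mul1r ?sin_pihalf.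
rewrite lnK ?posrE// cosB sinB cE sE sin_atan cos_atan E.
rewrite normrEsg; case: sg2 => ->.
  by congr (_ +i* _); field; rewrite ?y0 ?gt_eqF.
by congr (_ +i* _); field; rewrite ?y0 ?gt_eqF.
Qed.

Lemma expCD (Z W : C) : expC (Z + W) = expC Z * expC W.
Proof.
case: Z W => a b [c d]; apply: complexP; rewrite /= expRD ?cosD ?sinD; ring.
Qed.

Lemma expC0 : expC 0 = 1 :> C.
Proof. by apply: complexP; rewrite /= expR0 ?cos0 ?sin0 mul1r. Qed.

Lemma continuous_logC (Z : C^o) : Im Z != 0 -> logC W @[W --> Z] --> (logC Z : C^o).
Proof.
move=> Z0; have Zn : Z != 0 by apply: contraNneq Z0 => ->.
apply: (@cvg_Complex _ (nbhs Z)).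
  apply: continuous_comp; first exact: continuous_normc.
  by apply: continuous_ln; rewrite normc_gt0.
apply: cvgB.
  (* Off the real axis the sign of the imaginary part is locally constant. *)
  apply: cvgMl; apply: cvg_near_cst.
  have := @continuous_Im Z; case: sgrP Z0 => // s _ H; near=> W.
    by apply: gtr0_sg; near: W; exact: cvgr_gt H _ s.
  by apply: ltr0_sg; near: W; exact: cvgr_lt H _ s.
apply: continuous_comp; last exact: continuous_atan.
apply: (@cvgM _ _ (nbhs (Z : C^o))); first exact: continuous_Re.
by apply: (@cvgV _ _ (nbhs (Z : C^o))) => //; exact: continuous_Im.
Unshelve. all: by end_near. Qed.

(** The difference quotient of the exponential at 0, completed by its limit: it then converges along
    full neighbourhoods of 0 and composes with any function tending to 0. *)
Let phi (k : C^o) : C^o := if k == 0 then 1 else k^-1 * (expC k - 1).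

Let phi_cvg : phi k @[k --> (0 : C^o)] --> (1 : C^o).
Proof.
apply/(@cvg_complexP _ (nbhs (0 : C^o))) => e e0.
have e20 : 0 < e / 2 by rewrite divr_gt0.
have [r r0 rP] := expC_sub1 e20.
apply/nbhs_complexP; exists r => // k; rewrite subr0 => /rP kr.
rewrite /phi; have [_|k0] := eqVneq k 0; first by rewrite subrr Normc.normc0.
rewrite -[X in _ - X](mulVf k0) -mulrBr Normc.normcM Normc.normcV.
rewrite (le_lt_trans (y := e / 2))// ?ltr_pdivrMr ?ltr_pMr ?ltr1n//.
by rewrite mulrC ler_pdivrMr ?normc_gt0.
Qed.

(** Differentiation of an inverse function: for [k = logC (h + Z) - logC Z] one has
    [Z * expC k = h + Z], so the difference quotient [k / h] equals the inverse of [Z * phi k], and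
    [k] tends to 0 by continuity. *)
Lemma derivable_logC (Z : C^o) : Im Z != 0 -> derivable (logC : C^o -> C^o) Z 1.
Proof.
move=> Z0; have Zn : Z != 0 by apply: contraNneq Z0 => ->.
apply: (cvgP ((Z * 1)^-1 : C^o)).
pose k (h : C^o) : C^o := logC (h + Z) - logC Z.
have hZ : (h + Z : C^o) @[h --> (0 : C^o)^'] --> Z.
  apply: cvg_within_filter; apply/(@cvg_complexP _ (nbhs (0 : C^o))) => e e0.
  by apply/nbhs_complexP; exists e => // h; rewrite subr0 addrK.
have Im0 : \forall h \near (0 : C^o)^', Im (h + Z) != 0.
  have := cvg_comp _ _ hZ (@continuous_Im Z).
  move=> /cvgr_dist_lt; have Z1 : 0 < `|Im Z| by rewrite normr_gt0.
  move=> /(_ _ Z1); apply: filterS => h; apply: contraTneq => /= ->.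
  by rewrite subr0 ltxx.
have kE : \forall h \near (0 : C^o)^',
    (Z * phi (k h))^-1 = h^-1 *: (logC (h *: 1 + Z) - logC Z : C^o).
  near=> h.
  have h0 : h != 0 by near: h; exact: nbhs_dnbhs_neq.
  have hI : Im (h + Z) != 0 by near: h.
  rewrite [h *: 1]mulr1 -/(k h).
  have E : expC (logC Z) * expC (k h) = h + Z.
    by rewrite -expCD /k addrC subrK logCK.
  rewrite logCK// in E.
  have k0 : k h != 0.
    apply/eqP => kh; move: E; rewrite kh expC0 mulr1 => /eqP.
    by rewrite -subr_eq0 opprD addrCA subrr addr0 oppr_eq0 (negbTE h0).
  rewrite /phi (negbTE k0) mulrCA mulrBr E mulr1 addrK invfM invrK.
  by rewrite mulrC.
have kc : k h @[h --> (0 : C^o)^'] --> (0 : C^o).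
  apply/cvg_complexP => e e0.
  have /cvg_complexP/(_ e e0) := cvg_comp _ _ hZ (continuous_logC Z0).
  by apply: filterS => h; rewrite subr0.
apply: cvg_trans (near_eq_cvg kE) _.
apply: (@cvgV C^o); first by rewrite mulr1.
apply: (@cvgMr C^o).
exact: cvg_comp kc phi_cvg.
Unshelve. all: by end_near. Qed.

End complex_plane.

(** * The cylinder *)

Section cylinder.
Local Open Scope complex_scope.
Variable R : realType.
Local Notation C := R[i].
Local Notation normc := (@Normc.normc R).
Local Notation Re := (@complex.Re R).
Local Notation Im := (@complex.Im R).
Local Notation tau := (pi *+ 2 : R).

Lemma tau_gt0 : 0 < tau.
Proof. by rewrite pmulrn_rgt0// pi_gt0. Qed.

Lemma reduce_angle (t : R) : exists k : int, `|t - tau *~ k| <= pi.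
Proof.
have t0 := tau_gt0; exists (Num.floor ((t + pi) / tau)).
have /andP[] := floor_itv ((t + pi) / tau); set k := Num.floor _.
rewrite ler_pdivlMr// ltr_pdivrMr// -mulrzr intrD.
by move=> k1 k2; rewrite ler_norml; move: k1 k2; rewrite !mulr2n; lra.
Qed.

Lemma cosDtauz (t : R) (k : int) : cos (t + tau *~ k) = cos t.
Proof.
case: k => n; first by rewrite -pmulrn (periodicn (@cosD2pi R)).
by rewrite NegzE mulrNz -pmulrn -[LHS](periodicn (@cosD2pi R) n.+1) subrK.
Qed.

Lemma sinDtauz (t : R) (k : int) : sin (t + tau *~ k) = sin t.
Proof.
case: k => n; first by rewrite -pmulrn (periodicn (@sinD2pi R)).
by rewrite NegzE mulrNz -pmulrn -[LHS](periodicn (@sinD2pi R) n.+1) subrK.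
Qed.

Lemma cos_eq1 (t : R) : cos t = 1 -> exists k : int, t = tau *~ k.
Proof.
have [k tk] := reduce_angle t; exists k; apply/eqP; rewrite -subr_eq0 -normr_eq0.
have : cos `|t - tau *~ k| = cos 0.
  by rewrite cos_norm -mulrNz cosDtauz cos0.
by move=> /cos_inj ->//; rewrite in_itv /= ?lexx ?normr_ge0 ?pi_ge0.
Qed.

Lemma cyl_pi_period (Z : C) (k : int) : cyl_pi (Z + cyl_period R k) = cyl_pi Z.
Proof. by apply/cyl_piP; exists k; rewrite addrC addKr. Qed.

(** Equal moduli force equal real parts; the difference of the angles then has cosine 1. *)
Lemma expC_inj_cyl (Z W : C) : expC Z = expC W -> cyl_pi Z = cyl_pi W.
Proof.
case: Z W => a b [c d] [E1 E2].
have ac : a = c.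
  apply: (@expR_inj R); apply: (@pexpIrn _ 2) => //; rewrite ?nnegrE ?expR_ge0//.
  have H u v : expR u ^+ 2 = (expR u * cos v) ^+ 2 + (expR u * sin v) ^+ 2 :> R.
    by rewrite !exprMn -mulrDr cos2Dsin2 mulr1.
  by rewrite (H a b) (H c d) E1 E2.
move: E1 E2; rewrite ac => /mulfI E1 /mulfI E2.
have [k bd] : exists k : int, b - d = tau *~ k.
  apply: cos_eq1; rewrite cosB E1 ?E2 ?gt_eqF ?expR_gt0//.
  by rewrite -!expr2 cos2Dsin2.
by apply/cyl_piP; exists k; apply: complexP; rewrite /= ?ac ?subrr ?bd.
Qed.

Lemma cyl_distE (p q : cylinder R) r : ball p r q <-> cyl_dist p q < r.
Proof. by []. Qed.

(** A pair of lifts nearly realising the infimum can be translated by a common period so that its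
    first entry becomes [Z]. *)
Lemma cyl_ballP (Z : C) (r : R) (q : cylinder R) :
  ball (cyl_pi Z) r q <-> exists2 W, cyl_pi W = q & normc (Z - W) < r.
Proof.
split; rewrite cyl_distE /cyl_dist; set D := [set _ | _ in _] => H; last first.
  have [W Wq WZ] := H; apply: le_lt_trans WZ; apply: ge_inf.
    by exists 0 => _ [ZW _ <-]; exact: normc_ge0.
  by exists (Z, W).
have D0 : has_inf D.
  split; last by exists 0 => _ [ZW _ <-]; exact: normc_ge0.
  exists (normc (Z - cyl_repr q)), (Z, cyl_repr q) => //.
  by split => //; exact: cyl_reprK.
have [_ [[Z' W'] /= [Z'Z W'q]] <- lt_e] := inf_lt D0.1 H.
have /cyl_piP[k Zk] : cyl_pi Z = cyl_pi Z' by rewrite Z'Z.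
exists (W' + cyl_period R k); first by rewrite cyl_pi_period.
by rewrite -Zk opprD opprB addrCA [Z + (_ - Z)]addrC subrK addrC.
Qed.

Definition cyl_Re (p : cylinder R) : R := Re (cyl_repr p).

(** This value depends on the chosen representative. Only its class modulo [tau] has meaning, so it
    is used through [cos], [sin] or up to a multiple of [tau]. *)
Definition cyl_Im (p : cylinder R) : R := Im (cyl_repr p).

Lemma cyl_repr_pi (Z : C) : exists k : int, cyl_repr (cyl_pi Z) = Z + cyl_period R k.
Proof.
have /cyl_piP[k E] : cyl_pi (cyl_repr (cyl_pi Z)) = cyl_pi Z by rewrite cyl_reprK.
by exists k; rewrite -E addrC subrK.
Qed.

Lemma cyl_Re_pi (Z : C) : cyl_Re (cyl_pi Z) = Re Z.
Proof.
by rewrite /cyl_Re; have [k ->] := cyl_repr_pi Z; case: Z => a b /=; rewrite addr0.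
Qed.

Lemma cos_cyl_Im_pi (Z : C) : cos (cyl_Im (cyl_pi Z)) = cos (Im Z).
Proof.
by rewrite /cyl_Im; have [k ->] := cyl_repr_pi Z; case: Z => a b /=; rewrite cosDtauz.
Qed.

Lemma sin_cyl_Im_pi (Z : C) : sin (cyl_Im (cyl_pi Z)) = sin (Im Z).
Proof.
by rewrite /cyl_Im; have [k ->] := cyl_repr_pi Z; case: Z => a b /=; rewrite sinDtauz.
Qed.

Lemma cyl_norm_ge (p : cylinder R) : `|cyl_Re p| <= cyl_norm p.
Proof.
apply: lb_le_inf.
  by exists (normc (cyl_repr p)), (cyl_repr p) => //; exact: cyl_reprK.
by move=> _ [Z /= <- <-]; rewrite cyl_Re_pi; exact: Re_le_normc.
Qed.

(** Some lift has imaginary part at most [pi] in absolute value. Together with [cyl_norm_ge] this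
    lets the real part stand in for the norm. *)
Lemma cyl_norm_le (p : cylinder R) : cyl_norm p <= `|cyl_Re p| + pi.
Proof.
have [k Hk] := reduce_angle (cyl_Im p).
set Z := cyl_repr p + cyl_period R (- k).
have Zp : cyl_pi Z = p by rewrite cyl_pi_period cyl_reprK.
apply: (@le_trans _ _ (normc Z)).
  by apply: ge_inf; [exists 0 => _ [W _ <-]; exact: normc_ge0|exists Z].
apply: (le_trans (normc_le_ReIm _)).
have -> : Re Z = cyl_Re p by rewrite -(cyl_Re_pi Z) Zp.
rewrite lerD2l (_ : Im Z = cyl_Im p - tau *~ k)//.
by rewrite /Z /cyl_Im; case: (cyl_repr p) => a b /=; rewrite mulrNz.
Qed.

(** Balls of the cylinder are projections of balls of the plane, so preimages of open rays are
    open. *)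
Lemma measurable_fun_cyl (f : cylinder R -> R) (h : C^o -> R) :
  (forall Z : C, f (cyl_pi Z) = h Z) -> continuous h ->
  measurable_fun [set: cylinder R] f.
Proof.
move=> fh hc; apply: (measurability _ (RGenOInfty.measurableE R)).
move=> /= _ [_ [a ->]] <-; rewrite setTI; apply: sub_sigma_algebra => /=.
rewrite openE => p /=; rewrite in_itv /= andbT -(cyl_reprK p); set Z := cyl_repr p.
rewrite fh => aZ; have := hc Z => /cvgr_gt/(_ _ aZ)/nbhs_complexP[e e0 eP].
apply/nbhs_ballP; exists e => // _ /cyl_ballP[W <- WZ] /=.
by rewrite in_itv /= andbT fh; apply: eP; rewrite normc_distC.
Qed.

Lemma measurable_cyl_Re : measurable_fun setT cyl_Re.
Proof. by apply: (measurable_fun_cyl cyl_Re_pi); exact: continuous_Re. Qed.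

Lemma measurable_cos_cyl_Im : measurable_fun setT (cos \o cyl_Im).
Proof.
apply: (measurable_fun_cyl cos_cyl_Im_pi) => Z.
by apply: continuous_comp; [exact: continuous_Im|exact: continuous_cos].
Qed.

Lemma measurable_sin_cyl_Im : measurable_fun setT (sin \o cyl_Im).
Proof.
apply: (measurable_fun_cyl sin_cyl_Im_pi) => Z.
by apply: continuous_comp; [exact: continuous_Im|exact: continuous_sin].
Qed.

End cylinder.

(** * Inverse branches off the real line *)

Section inverse_branches.
Local Open Scope complex_scope.
Variable R : realType.
Local Notation C := R[i].
Local Notation normc := (@Normc.normc R).
Local Notation Re := (@complex.Re R).
Local Notation Im := (@complex.Im R).
Local Notation tau := (pi *+ 2 : R).

(** The strips are the components of the lift of the cylinder minus its real line. *)
Definition strip (k : int) : set C :=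
  [set Z | tau *~ k < Im Z < tau *~ (k + 1)].

Lemma mulrz_tau_lt (k l : int) : (tau *~ k < tau *~ l) = (k < l).
Proof. by rewrite -!(mulrzr tau) ltr_pM2l ?tau_gt0// ltr_int. Qed.

Lemma logC_strip (Z : C) :
  (0 < Im Z -> strip 0 (logC Z)) /\ (Im Z < 0 -> strip (-1) (logC Z)).
Proof.
rewrite /strip /logC /= add0r addNr mulr0z mulr1z mulrNz mulr1z.
have := atan_gtNpi2 (Re Z / Im Z); have := atan_ltpi2 (Re Z / Im Z).
have := pi_gt0 R; rewrite !(mulr2n (pi : R)) => *; split => Z0.
  by rewrite (gtr0_sg Z0); apply/andP; split; lra.
by rewrite (ltr0_sg Z0); apply/andP; split; lra.
Qed.

Lemma exp_map_logC (a : R) (Z : C) : a != 0 -> Im Z != 0 ->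
  exp_map a (logC (a^-1%:C * Z)) = Z.
Proof.
move=> a0 Z0; rewrite /exp_map logCK; first by rewrite mulrA -rmorphM divff// mul1r.
by case: Z Z0 => x y /= y0; rewrite mul0r addr0 mulf_neq0// invr_neq0.
Qed.

Lemma derivable_comp (f g : C^o -> C^o) (Z : C^o) :
  derivable f Z 1 -> derivable g (f Z) 1 -> derivable (g \o f) Z 1.
Proof.
move=> df dg; have df' := (@derivable1_diffP C C^o f Z).1 df.
have dg' := (@derivable1_diffP C C^o g (f Z)).1 dg.
exact: (@derivable1_diffP C C^o (g \o f) Z).2 (differentiable_comp df' dg').
Qed.

Section random_dynamics.
Variables (d : measure_display) (Omega : measurableType d).
Variables (theta : Omega -> Omega) (eta : Omega -> R).
Hypothesis eta_gt0 : forall omega, 0 < eta omega.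

(* A lift with values in a strip, translated by a period so as to pass through the
   exact value of [f] along the orbit, stays in an open half-plane; the logarithm
   applies to it and again has values in a strip. *)
Lemma lift_inverse_iter (n : nat) (omega : Omega) (z : cylinder R)
    (D : set C) (W : C) (G : C^o -> C^o) (k : int) :
  D W -> (forall V, D V -> derivable G V 1) -> (forall V, D V -> strip k (G V)) ->
  cyl_pi (G W) = fiber_iter theta eta n omega z ->
  exists G' : C^o -> C^o, [/\ (forall V, D V -> derivable G' V 1),
    (forall V, D V -> fiber_iter theta eta n omega (cyl_pi (G' V)) = cyl_pi (G V)) &
    cyl_pi (G' W) = z].
Proof.
move=> DW; elim: n => [|n IHn] in G k * => dG Gk GW; first by exists G.
move: GW; rewrite /= /fiber_map; set a := eta _; set w := fiber_iter _ _ _ _ _.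
have a0 : a != 0 by rewrite gt_eqF ?eta_gt0.
(* The period [j] separates the lift [G W] from the exact exponential of the representative of the
   previous orbit point [w]. *)
rewrite -(cyl_reprK w) cyl_map_pi => /esym/cyl_piP[j Wj].
pose c := cyl_period R j.
pose G1 (V : C^o) : C^o := logC (a^-1%:C * (G V + c)).
have ImGc V : D V -> tau *~ (k + j) < Im (G V + c) < tau *~ (k + j + 1).
  move=> /Gk; rewrite /strip /= addrAC ![tau *~ (_ + j)]mulrzDr.
  by case: (G V) => x y /=; rewrite !ltrD2r.
have sgGc : (forall V, D V -> 0 < Im (G V + c)) \/ (forall V, D V -> Im (G V + c) < 0).
  have [kj|kj] := leP 0 (k + j); [left|right] => V /ImGc /andP[lo hi].
    apply: le_lt_trans lo; rewrite -(mulr0z tau) leNgt mulrz_tau_lt -leNgt//.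
  apply: (lt_le_trans hi); rewrite -(mulr0z tau) leNgt mulrz_tau_lt -leNgt.
  by rewrite lezD1.
have Im0 V : D V -> Im (G V + c) != 0.
  by move=> DV; case: sgGc => /(_ _ DV) H; [rewrite gt_eqF|rewrite lt_eqF].
have Ima V : Im (a^-1%:C * (G V + c)) = a^-1 * Im (G V + c).
  by case: (G V + c) => x y /=; rewrite mul0r addr0.
have a'0 : 0 < a^-1 by rewrite invr_gt0 eta_gt0.
have [l G1l] : exists l, forall V, D V -> strip l (G1 V).
  case: sgGc => H; [exists 0|exists (-1)] => V /H H0.
    by apply: (logC_strip _).1; rewrite Ima pmulr_rgt0.
  by apply: (logC_strip _).2; rewrite Ima pmulr_rlt0.
have dG1 V : D V -> derivable G1 V 1.
  move=> DV; apply: (@derivable_comp (fun V => a^-1%:C * (G V + c))).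
    by apply: derivableM => //; apply: derivableD => //; exact: dG.
  by apply: derivable_logC; rewrite Ima mulf_neq0 ?Im0 ?gt_eqF.
have eG1 V : D V -> exp_map a (G1 V) = G V + c.
  by move=> DV; apply: exp_map_logC => //; exact: Im0.
(* Both sides have the same exponential, which is injective on the cylinder. *)
have G1W : cyl_pi (G1 W) = w.
  rewrite -(cyl_reprK w); apply: expC_inj_cyl.
  have /(congr1 (fun Z => a^-1%:C * Z)) : exp_map a (G1 W) = exp_map a (cyl_repr w).
    by rewrite eG1// /c -Wj addrC subrK.
  by rewrite /exp_map !mulrA -!rmorphM mulVf// !mul1r.
have [G' [dG' FG' G'W]] := IHn G1 l dG1 G1l G1W.
exists G'; split => // V DV.
by rewrite /= FG'// /fiber_map cyl_map_pi eG1// /c cyl_pi_period.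
Qed.

(** The disc around the representative lies in one strip, so the identity is a lift from which
    [lift_inverse_iter] starts. Its diameter is at most [tau], so the disc embeds in the cylinder
    and the lifted branch descends. *)
Lemma inverse_branch_off_real (n : nat) (omega : Omega) (z : cylinder R) (r : R) :
  0 < r ->
  (forall k : int, r <= `|cyl_Im (fiber_iter theta eta n omega z) - tau *~ k|) ->
  exists g, inverse_branch theta eta n omega z r g.
Proof.
set w := fiber_iter _ _ _ _ _; pose W0 := cyl_repr w => r0 rIm.
have ImD (Z W : C) : Im (Z - W) = Im Z - Im W by case: Z W => ? ? [].
pose D : set C := [set V | normc (V - W0) < r].
have t0 := @tau_gt0 R.
have /andP[] := floor_itv (Im W0 / tau); set k := Num.floor _.
rewrite ler_pdivlMr// ltr_pdivrMr// ![_ * tau]mulrC !mulrzr => k1 k2.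
have {}k1 : r <= Im W0 - tau *~ k.
  by have := rIm k; rewrite ger0_norm// subr_ge0.
have {}k2 : r <= tau *~ (k + 1) - Im W0.
  by have := rIm (k + 1); rewrite distrC gtr0_norm// subr_gt0.
have Dk V : D V -> strip k V.
  move=> /(le_lt_trans (Im_le_normc _)); rewrite ImD /strip /= ltr_norml => /andP[].
  by move: k1 k2; rewrite /= mulrzDr mulr1z => *; apply/andP; split; lra.
have rtau : r + r <= tau.
  move: (lerD k1 k2); rewrite mulrzDr mulr1z; lra.
have DW0 : D W0 by rewrite /D /= subrr Normc.normc0.
have [G' [dG' FG' G'W]] := @lift_inverse_iter n omega z D W0 id k DW0
  (fun V _ => @derivable_id _ C^o V 1) Dk (cyl_reprK w).
(* Imaginary parts of two points of [D] differ by less than [r + r <= tau], so a period between them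
   is zero. *)
have Duniq V V' : D V -> D V' -> cyl_pi V = cyl_pi V' -> V = V'.
  move=> DV DV' /cyl_piP[j VV'].
  have : `|tau *~ j| < tau.
    have -> : tau *~ j = Im (V - V') by rewrite VV'.
    apply: (le_lt_trans (Im_le_normc _)); apply: lt_le_trans rtau.
    rewrite -(subrKA W0) (le_lt_trans (le_normcD _ _))//.
    by rewrite ltrD// normc_distC.
  rewrite ltr_norml => /andP[j1 j2].
  have {}j1 : -1 < j by rewrite -mulrz_tau_lt mulrNz mulr1z.
  have {}j2 : j < 1 by rewrite -mulrz_tau_lt mulr1z.
  have j0 : j = 0 by lia.
  by apply/eqP; rewrite -subr_eq0 VV' j0 /cyl_period mulr0z.
(* On the ball, [xget] returns the unique lift in [D]; elsewhere it returns the default [W0]. *)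
pose g (p : cylinder R) := cyl_pi (G' (xget W0 [set V | D V /\ cyl_pi V = p])).
have gE V : D V -> g (cyl_pi V) = cyl_pi (G' V).
  move=> DV; rewrite /g; congr (cyl_pi (G' _)); case: xgetP => [V' _ [DV' VV']|/(_ V)].
    exact: Duniq.
  by case.
have ballD p : ball w r p -> exists2 V, D V & cyl_pi V = p.
  rewrite -(cyl_reprK w) => /cyl_ballP[V Vp WV]; exists V => //.
  by rewrite /D /= normc_distC.
exists g; split.
- move=> Z /ballD[V DV VZ].
  (* The lift [Z] given by the chart need not lie in [D]; the period [j] carries it to [V] in
     [D]. *)
  have /cyl_piP[j Vj] := VZ.
  pose s (U : C^o) : C^o := U + cyl_period R j.
  have nD : \forall U \near Z, D (s U).
    apply/nbhs_complexP; exists (r - normc (V - W0)); first by rewrite subr_gt0.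
    move=> U UZ; rewrite /D /= /s -Vj.
    have -> : U + (V - Z) - W0 = (U - Z) + (V - W0).
      by rewrite -!addrA; congr (_ + _); rewrite addrCA.
    by rewrite (le_lt_trans (le_normcD _ _))// -ltrBrDr.
  exists (G' \o s); split; near=> U.
    apply: derivable_comp; first by apply: derivableD.
    by apply: dG'; near: U.
  by rewrite -(cyl_pi_period U j) gE//; near: U.
- by move=> p /ballD[V DV <-]; rewrite gE// FG'.
- by rewrite -/w -[in LHS](cyl_reprK w) gE.
Unshelve. all: by end_near. Qed.

End random_dynamics.
End inverse_branches.

(** * Escape along the real line *)

Section escape.
Local Open Scope complex_scope.
Variable R : realType.
Local Notation C := R[i].
Local Notation tau := (pi *+ 2 : R).

Lemma ler_abs_sin (t : R) : `|sin t| <= `|t|.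
Proof.
wlog t0 : t / 0 <= t.
  have [t0 H|t0 H] := leP 0 t; first exact: H.
  by rewrite -normrN -sinN -[leRHS]normrN; apply: H; rewrite oppr_ge0 ltW.
have [s _] : exists2 s, s \in `[0, t] & sin t - sin 0 = cos s * (t - 0).
  by apply: MVT_segment => //; apply: continuous_subspaceT => x; exact: continuous_sin.
rewrite sin0 !subr0 => ->; rewrite normrM ler_piMl//.
by rewrite ler_norml cos_geN1 cos_le1.
Qed.

Lemma ler_cos (t : R) : 1 - `|t| <= cos t.
Proof.
wlog t0 : t / 0 <= t.
  have [t0 H|t0 H] := leP 0 t; first exact: H.
  by rewrite -normrN -cosN; apply: H; rewrite oppr_ge0 ltW.
have [s _] : exists2 s, s \in `[0, t] & cos t - cos 0 = (- sin s) * (t - 0).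
  by apply: MVT_segment => //; apply: continuous_subspaceT => x; exact: continuous_cos.
rewrite cos0 subr0 ger0_norm// mulNr => E.
have : sin s * t <= t by rewrite ler_piMl// sin_le1.
lra.
Qed.

(** * Drift of the orbits that start near the real line *)

Definition near_real (r : R) (p : cylinder R) : Prop :=
  exists k : int, `|cyl_Im p - tau *~ k| < r.

Lemma cyl_map_coord (a : R) (p : cylinder R) :
  cyl_map a p = cyl_pi ((a * (expR (cyl_Re p) * cos (cyl_Im p)))
                     +i* (a * (expR (cyl_Re p) * sin (cyl_Im p)))).
Proof.
rewrite /cyl_map; congr cyl_pi.
by apply: complexP; rewrite /exp_map /expC /= !mul0r ?subr0 ?addr0.
Qed.

Lemma near_real_pi (r : R) (Z : C) : `|complex.Im Z| < r -> near_real r (cyl_pi Z).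
Proof.
move=> Zr; have [k E] := cyl_repr_pi Z; exists k.
by rewrite /cyl_Im E; case: Z Zr {E} => x y /=; rewrite addrK.
Qed.

Section step.
Variables (A B c : R).
Hypotheses (A_gt0 : 0 < A) (cA : c + c <= 1 + ln A).

(** On the real line [a * expR x >= 1 + ln A + x >= x + 2 c]. The cosine of the deviation [s] costs
    at most [a * expR x * |s| <= c], and one step multiplies the deviation by at most
    [B * expR M]. *)
Lemma cyl_map_near_real (a M r : R) (p : cylinder R) :
  A <= a <= B -> cyl_Re p <= M -> 0 < r -> B * expR M * r <= c -> near_real r p ->
  [/\ cyl_Re p + c <= cyl_Re (cyl_map a p), cyl_Re (cyl_map a p) <= B * expR M
    & near_real (B * expR M * r) (cyl_map a p)].
Proof.
move=> /andP[Aa aB] pM r0 Mr [k]; set s := _ - _ => sr.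
have Es : cyl_Im p = s + tau *~ k by rewrite subrK.
rewrite cyl_map_coord Es cosDtauz sinDtauz cyl_Re_pi /=.
set x := cyl_Re p in pM *; have a0 : 0 < a by exact: lt_le_trans Aa.
have B0 : 0 < B by exact: lt_le_trans aB.
have xM : a * expR x <= B * expR M.
  by apply: ler_pM; rewrite ?expR_ge0 ?ler_expR // ltW.
have ax0 : 0 < a * expR x by rewrite mulr_gt0 ?expR_gt0.
have BM0 : 0 < B * expR M by rewrite mulr_gt0 ?expR_gt0.
have lo : x + c + c <= a * expR x.
  apply: (@le_trans _ _ (expR (ln A + x))).
    apply: (le_trans _ (expR_ge1Dx _)); by move: cA; lra.
  by rewrite expRD lnK ?posrE// ler_pM2r ?expR_gt0.
rewrite !mulrA; split.
- have := ler_cos s; rewrite -(ler_pM2l ax0) mulrBr mulr1; apply: le_trans.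
  have : a * expR x * `|s| <= B * expR M * r by rewrite ler_pM// ltW.
  lra.
- by rewrite (le_trans _ xM)// ler_piMr ?cos_le1// ltW.
- apply: near_real_pi => /=.
  rewrite normrM (gtr0_norm ax0).
  apply: (@le_lt_trans _ _ (B * expR M * `|s|)); last by rewrite ltr_pM2l.
  by rewrite ler_pM ?ler_abs_sin// ltW.
Qed.

End step.

Section random_dynamics.
Variables (d : measure_display) (Omega : measurableType d).
Variables (theta : Omega -> Omega) (eta : Omega -> R).
Local Notation iterF := (fiber_iter theta eta).

Lemma fiber_iterD (m n : nat) (omega : Omega) (z : cylinder R) :
  iterF (m + n) omega z = iterF m (iter n theta omega) (iterF n omega z).
Proof. by elim: m => //= m ->; rewrite iterD. Qed.

Lemma real_escape (A B : R) : (expR 1)^-1 < A ->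
  (forall omega, A <= eta omega <= B) ->
  forall N : R, exists K : nat, exists2 r, 0 < r &
    forall omega z, `|cyl_Re z| <= N -> near_real r z -> N < cyl_Re (iterF K omega z).
Proof.
move=> Ae etaAB N.
have A0 : 0 < A by rewrite (lt_trans _ Ae)// invr_gt0 expR_gt0.
(* Half of the drift, positive because [A] exceeds 1/e; the other half absorbs the loss from the
   cosine. *)
pose c := (1 + ln A) / 2.
have c0 : 0 < c.
  rewrite divr_gt0// -ltrBlDl sub0r -[ltLHS]expRK ltr_ln ?posrE ?expR_gt0//.
  by rewrite expRN.
have cA : c + c <= 1 + ln A by rewrite -splitr.
have steps n : forall M, exists2 r, 0 < r & forall omega z,
    cyl_Re z <= M -> near_real r z -> cyl_Re z + c *+ n <= cyl_Re (iterF n omega z).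
  elim: n => [|n IHn] M; first by exists 1 => // omega z _ _; rewrite addr0.
  have [r r0 Hr] := IHn (B * expR M).
  (* The maximum with 1 makes the divisor positive. *)
  pose b := Num.max 1 (B * expR M).
  have b0 : 0 < b by rewrite lt_max ltr01.
  have bB : B * expR M <= b by rewrite le_max lexx orbT.
  (* The bound [c / b] makes the drift estimate apply to the first step; [r / b] keeps its image
     within [r] of the real line for the other [n] steps. *)
  exists (Num.min (c / b) (r / b)); first
    by rewrite lt_min (divr_gt0 c0 b0) (divr_gt0 r0 b0).
  move=> omega z zM; set r' := Num.min _ _ => nz.
  have r'0 : 0 < r' by rewrite lt_min (divr_gt0 c0 b0) (divr_gt0 r0 b0).
  have bc : B * expR M * r' <= c.
    apply: (@le_trans _ _ (b * r')); first by rewrite ler_pM2r.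
    by rewrite mulrC -ler_pdivlMr// ge_min lexx.
  have br : B * expR M * r' <= r.
    apply: (@le_trans _ _ (b * r')); first by rewrite ler_pM2r.
    by rewrite mulrC -ler_pdivlMr// ge_min lexx orbT.
  have [up bnd [k nr]] := cyl_map_near_real A0 cA (etaAB omega) zM r'0 bc nz.
  rewrite -addn1 fiber_iterD /=.
  apply: le_trans (Hr _ _ bnd _); last by exists k; exact: lt_le_trans nr br.
  by rewrite addn1 mulrS addrA lerD2r.
(* A total gain above [2 N] carries a real part that is at least [-N] beyond [N]. *)
pose K := (Num.truncn ((N + N) / c)).+1.
have [r r0 Hr] := steps K N; exists K, r => // omega z zN nz.
have := Hr omega z (le_trans (ler_norm _) zN) nz; apply: lt_le_trans.
have : N + N < c *+ K by rewrite -mulr_natr mulrC -ltr_pdivrMr// truncnS_gt.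
by have := zN; rewrite ler_norml => /andP[]; lra.
Qed.

Lemma good_times_le (omega : Omega) (z : cylinder R) (N n : nat) :
  good_times theta eta omega z N n -> `|cyl_Re (iterF n omega z)| <= N%:R.
Proof. by move=> [zN _]; exact: le_trans (cyl_norm_ge _) zN. Qed.

(** An orbit point within [r] of the real line would have real part above [N] after [K] steps.
    Boundedness at both times thus keeps it at distance [r], where inverse branches exist. *)
Lemma recurrent_good_times (A B : R) : (expR 1)^-1 < A ->
  (forall omega, A <= eta omega <= B) ->
  forall N : nat, exists K N0 : nat, forall omega z N' n, (N0 <= N')%N ->
    `|cyl_Re (iterF n omega z)| <= N%:R ->
    `|cyl_Re (iterF (K + n) omega z)| <= N%:R ->
    good_times theta eta omega z N' n.
Proof.
move=> Ae etaAB N; have [K [r r0 HK]] := real_escape Ae etaAB N%:R.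
have eta0 omega : 0 < eta omega.
  have /andP[/(lt_le_trans Ae) + _] := etaAB omega.
  by apply: lt_trans; rewrite invr_gt0 expR_gt0.
(* [N + pi] bounds the norm at time [n], and [2 / r] makes the radius [2 / N'] at most [r]. *)
pose b : R := Num.max (N%:R + pi) (2 / r).
exists K, (Num.truncn b).+1 => omega z N' n N0 zN zKN.
have bN' : b < N'%:R by rewrite (lt_le_trans (truncnS_gt b))// ler_nat.
have N'0 : 0 < N'%:R :> R by rewrite (le_lt_trans _ bN')// le_max divr_ge0 ?orbT// ltW.
split.
  rewrite (le_trans (cyl_norm_le _))// (le_trans _ (ltW bN'))// le_max.
  by rewrite lerD2r zN.
apply: inverse_branch_off_real => //; first by rewrite divr_gt0.
move=> k; rewrite leNgt; apply/negP => nk.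
have : near_real r (iterF n omega z).
  exists k; apply: lt_le_trans nk _; rewrite ler_pdivrMr// mulrC -ler_pdivrMr//.
  by rewrite ltW// (le_lt_trans _ bN')// le_max lexx orbT.
move=> /(HK (iter n theta omega) _ zN); rewrite -fiber_iterD => /lt_geF.
by rewrite (le_trans (ler_norm _) zKN).
Qed.

End random_dynamics.
End escape.

(** * Lower density *)

Section density.
Variable R : realType.

Definition visits (S : set nat) (k : nat) : nat := \sum_(1 <= i < k.+1) `[< S i >].

Let freq (S : set nat) (k : nat) : R := k%:R^-1 * (visits S k)%:R.

Lemma visits_le (S : set nat) (k : nat) : (visits S k <= k)%N.
Proof.
rewrite -[leqRHS](subn0 k) -[leqRHS]muln1 -subSS -sum_nat_const_nat.
by apply: leq_sum => i _; case: asboolP.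
Qed.

Lemma visitsS (S T : set nat) (k : nat) : S `<=` T -> (visits S k <= visits T k)%N.
Proof.
move=> ST; apply: leq_sum => i _.
by case: asboolP => // /ST Ti; rewrite asboolT.
Qed.

Lemma visitsC (S : set nat) (k : nat) : (visits S k + visits (~` S) k = k)%N.
Proof.
rewrite -[RHS](subn0 k) -[RHS]muln1 -subSS -sum_nat_const_nat -big_split/=.
by apply: eq_bigr => i _; rewrite asbool_neg; case: asboolP.
Qed.

Lemma visits_subadd (S T : set nat) (k : nat) :
  (visits (S `|` T) k <= visits S k + visits T k)%N.
Proof.
rewrite -big_split; apply: leq_sum => i _ /=.
by rewrite asbool_or; case: asboolP; case: asboolP.
Qed.

Lemma visits_shift (S : set nat) (K k : nat) :
  (visits [set i | S (K + i)%N] k <= visits S (K + k))%N.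
Proof.
rewrite {2}/visits (@big_cat_nat _ _ _ (1 + K))//=; last by rewrite add1n ltnS leq_addr.
rewrite (leq_trans _ (leq_addl _ _))// big_addn -addnS addnC addnK.
by apply: leq_sum => i _; rewrite /= addnC.
Qed.

Let freq_le1 (S : set nat) (k : nat) : freq S k <= 1.
Proof.
rewrite /freq; case: k => [|k]; first by rewrite invr0 mul0r.
by rewrite mulrC ler_pdivrMr ?ltr0Sn// mul1r ler_nat visits_le.
Qed.

Let freq_ge0 (S : set nat) (k : nat) : 0 <= freq S k.
Proof. by rewrite mulr_ge0// invr_ge0. Qed.

Let freq_has_lbound (S : set nat) n : has_lbound (sdrop (freq S) n).
Proof. by exists 0 => _ [k _ <-]. Qed.

(** The frequencies lie between 0 and 1, so the lower limit is a supremum of infima of tails. *)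
Lemma lower_densityE (S : set nat) :
  lower_density R S = sup (range (infs (freq S))).
Proof.
apply: limn_infE; exists 1; split; first exact: num_real.
move=> x x1 k _ /=; rewrite ger0_norm//.
by rewrite (le_trans (freq_le1 S k))// ltW.
Qed.

Let infs_le1 (S : set nat) n : infs (freq S) n <= 1.
Proof. by apply: le_trans (freq_le1 S n); apply: ge_inf => //; exists n => //=. Qed.

Let infs_has_sup (S : set nat) : has_sup (range (infs (freq S))).
Proof. by split; [exists (infs (freq S) 0%N), 0%N|exists 1 => _ [n _ <-]]. Qed.

Lemma lower_density_le1 (S : set nat) : lower_density R S <= 1.
Proof.
rewrite lower_densityE; apply: sup_le_ub; first exact: (infs_has_sup S).1.
by move=> _ [n _ <-].
Qed.

Lemma lower_density_ge (S : set nat) (c : R) (k0 : nat) :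
  (forall k, (k0 <= k)%N -> c * k%:R <= (visits S k)%:R) -> (0 < k0)%N ->
  c <= lower_density R S.
Proof.
move=> Sc k00; rewrite lower_densityE; apply: (@le_trans _ _ (infs (freq S) k0)).
  apply: lb_le_inf; first by exists (freq S k0), k0 => //=.
  (* Here [0 < k0] excludes [k = 0], where the frequency is 0 by the convention on inverses. *)
  move=> _ [k /= k0k <-]; rewrite /freq mulrC ler_pdivlMr ?Sc//.
  by rewrite ltr0n (leq_trans k00).
by apply: ub_le_sup; [exact: (infs_has_sup S).2|exists k0].
Qed.

Lemma lower_density_gt (S : set nat) (c : R) : c < lower_density R S ->
  exists k0, forall k, (k0 <= k)%N -> c * k%:R <= (visits S k)%:R.
Proof.
rewrite lower_densityE => /(sup_gt (infs_has_sup S).1)[_ [k0 _ <-] ck0].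
exists k0 => -[|k] k0k; first by rewrite mulr0.
rewrite -ler_pdivlMr ?ltr0Sn// mulrC; apply: le_trans (ltW ck0) _.
by apply: ge_inf => //; exists k.+1.
Qed.

End density.

(** * A maximal ergodic inequality *)

(** Frequency above [1 / e] in a window, multiplied out to stay in [nat]. The bound [n] on window
    lengths keeps the covering finite and is removed later by a limit. *)
Definition excess (b : nat -> bool) (e n j : nat) : Prop :=
  exists k, [/\ (0 < k)%N, (k <= n)%N & (k < e * \sum_(j <= i < j + k) b i)%N].

(* Greedy covering: an excess at [j] pays for the [k] times following [j]. *)
Lemma sum_excess_le (b : nat -> bool) (e n j L : nat) :
  (\sum_(j <= i < j + L) `[< excess b e n i >] <= e * \sum_(j <= i < j + (L + n)) b i)%N.
Proof.
elim/ltn_ind: L => L IHL in j *.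
case: L IHL => [|L] IHL; first by rewrite addn0 big_geq.
have cat (c : nat -> nat) u v : (\sum_(j <= i < j + (u + v)) c i =
    \sum_(j <= i < j + u) c i + \sum_(j + u <= i < j + u + v) c i)%N.
  by rewrite addnA (@big_cat_nat _ _ _ (j + u)) ?leq_addr.
have [[k [k0 kn kb]]|nE] := pselect (excess b e n j); last first.
  rewrite addSn -!addSnnS !(@big_ltn _ _ _ j) ?addSn ?ltnS ?leq_addr//.
  rewrite asboolF// add0n mulnDr -!addSn.
  by rewrite (leq_trans (IHL L _ _))// leq_addl.
have [kL|Lk] := leqP k L.+1.
  rewrite -{1}(subnKC kL) cat.
  rewrite (_ : L.+1 + n = k + (L.+1 - k + n))%N; last by rewrite addnA subnKC.
  rewrite cat mulnDr leq_add//; last first.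
    by apply: IHL; rewrite ltn_subrL k0.
  apply: leq_trans (ltnW kb).
  rewrite -[leqRHS](addKn j) -[leqRHS]muln1 -sum_nat_const_nat.
  by apply: leq_sum => i _; case: asboolP.
(* The window extends past all remaining starting points; the [n] additional terms on the right
   leave room for it. *)
apply: (@leq_trans k).
  rewrite (leq_trans _ (ltnW Lk))// -[leqRHS](addKn j) -[leqRHS]muln1 -sum_nat_const_nat.
  by apply: leq_sum => i _; case: asboolP.
rewrite (leq_trans (ltnW kb))// leq_mul2l; apply/orP; right.
have -> : (L.+1 + n = k + (L.+1 + n - k))%N.
  by rewrite subnKC// (leq_trans kn)// leq_addl.
by rewrite cat leq_addr.
Qed.

Section maximal_inequality.
Context d (T : measurableType d) (R : realType).
Variables (mu : probability T R) (f : T -> T) (B : nat -> set T).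
Hypothesis mB : forall i, measurable (B i).
Hypothesis Bf : forall i, B i.+1 = f @^-1` B i.
Hypothesis mu_inv : forall E, measurable E -> mu (f @^-1` E) = mu E.

Let b x i := `[< B i x >].

Let sum_indic (C : nat -> set T) m n x :
  \sum_(m <= i < n) (\1_(C i) x : R) = (\sum_(m <= i < n) `[< C i x >])%:R.
Proof. by rewrite natr_sum; apply: eq_bigr => i _; rewrite indicE. Qed.

Lemma measurable_sum_visits e k m n :
  measurable [set x | (k < e * \sum_(m <= i < n) `[< B i x >])%N].
Proof.
have -> : [set x | (k < e * \sum_(m <= i < n) `[< B i x >])%N] =
    (fun x => e%:R * \sum_(m <= i < n) (\1_(B i) x : R)) @^-1` `]k%:R, +oo[%classic.
  apply/seteqP; split=> x; rewrite /preimage /mkset sum_indic -natrM /= in_itv /= andbT;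
    by rewrite ltr_nat.
rewrite -[X in measurable X]setTI.
apply: measurable_funM => //; apply: measurable_sum => i.
exact: measurable_indic.
Qed.

Let E e n j := [set x | excess (b x) e n j].

Let mE e n j : measurable (E e n j).
Proof.
have -> : E e n j = \bigcup_(k in [set k | (0 < k <= n)%N])
    [set x | (k < e * \sum_(j <= i < j + k) `[< B i x >])%N].
  apply/seteqP; split => x.
    by move=> [k [k0 kn kb]]; exists k => //=; rewrite k0.
  by move=> [k /= /andP[k0 kn] kb]; exists k.
by apply: bigcup_measurable => k _; exact: measurable_sum_visits.
Qed.

Let EfS e n j : E e n j.+1 = f @^-1` E e n j.
Proof.
have H x k : (\sum_(j.+1 <= i < j.+1 + k) b x i = \sum_(j <= i < j + k) b (f x) i)%N.
  by rewrite addSn big_add1; apply: eq_bigr => i _; rewrite /b Bf.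
apply/seteqP; split => x [k [k0 kn kb]]; exists k; split => //.
  by rewrite -H.
by rewrite H.
Qed.

Let mu_E e n j : mu (E e n j) = mu (E e n 0).
Proof. by elim: j => // j <-; rewrite EfS mu_inv. Qed.

Let mu_B i : mu (B i) = mu (B 0).
Proof. by elim: i => // i <-; rewrite Bf mu_inv. Qed.

(** Integrating the covering bound over [L] starting points gives, by invariance,
    [L * a <= e * (L + n) * c]; the contribution of [n] becomes negligible for large [L]. *)
Lemma maximal_inequality_fin e n j : (mu (E e n j) <= e%:R%:E * mu (B 0))%E.
Proof.
rewrite mu_E; set a := mu (E e n 0); set c := mu (B 0).
have aR : a \is a fin_num by exact: fin_num_measure.
have cR : c \is a fin_num by exact: fin_num_measure.
have H (L : nat) : (L%:R%:E * a <= (e * (L + n))%:R%:E * c)%E.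
  have -> : (L%:R%:E * a = \int[mu]_x (\sum_(0 <= i < L) (\1_(E e n i) x)%:E))%E.
    rewrite ge0_integral_sum//; last first.
      by move=> i; apply/measurable_EFinP; exact: measurable_indic.
    rewrite (eq_bigr (fun=> a)); last first.
      by move=> i _; rewrite integral_indic// setIT; exact: mu_E.
    by rewrite -(fineK aR) sumEFin sumr_const_nat subn0 -(mulr_natl (fine a)) EFinM.
  have -> : ((e * (L + n))%:R%:E * c =
      \int[mu]_x (e%:R%:E * \sum_(0 <= i < L + n) (\1_(B i) x)%:E))%E.
    rewrite ge0_integralZl_EFin//; last 2 first.
    - by move=> x _; apply: sume_ge0 => i _; rewrite lee_fin.
    - by apply: emeasurable_sum => i; apply/measurable_EFinP; exact: measurable_indic.
    rewrite ge0_integral_sum//; last first.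
      by move=> i; apply/measurable_EFinP; exact: measurable_indic.
    rewrite (eq_bigr (fun=> c)); last first.
      by move=> i _; rewrite integral_indic// setIT; exact: mu_B.
    rewrite -(fineK cR) sumEFin sumr_const_nat subn0 -(mulr_natl (fine c)).
    by rewrite natrM !EFinM muleA.
  apply: ge0_le_integral => //.
  - by move=> x _; apply: sume_ge0 => i _; rewrite lee_fin.
  - by apply: emeasurable_sum => i; apply/measurable_EFinP; exact: measurable_indic.
  - apply: measurable_funeM.
    by apply: emeasurable_sum => i; apply/measurable_EFinP; exact: measurable_indic.
  move=> x _; rewrite !sumEFin -EFinM lee_fin.
  rewrite !sum_indic -natrM ler_nat.
  exact: (@sum_excess_le (b x) e n 0 L).
rewrite -(fineK aR) -(fineK cR) -EFinM lee_fin.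
rewrite leNgt; apply/negP => ca.
(* If [a > e * c], this [L] makes [L * (a - e * c)] exceed the boundary term [e * n * c]. *)
pose L := (Num.truncn (e%:R * n%:R * fine c / (fine a - e%:R * fine c))).+1.
have := truncnS_gt (e%:R * n%:R * fine c / (fine a - e%:R * fine c)).
rewrite -/L ltr_pdivrMr ?subr_gt0// => LL.
have := H L; rewrite -(fineK aR) -(fineK cR) -!EFinM lee_fin natrM natrD.
by move: LL; rewrite mulrBr; lra.
Qed.

(** The sets with window lengths bounded by [n] increase to this one, so continuity from below
    applies. *)
Lemma maximal_inequality e j :
  (mu [set x | exists k, (0 < k)%N /\ (k < e * \sum_(j <= i < j + k) `[< B i x >])%N]
   <= e%:R%:E * mu (B 0))%E.
Proof.
have -> : [set x | exists k, (0 < k)%N /\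
    (k < e * \sum_(j <= i < j + k) `[< B i x >])%N] = \bigcup_n E e n j.
  apply/seteqP; split => x [k].
    by move=> [k0 kb]; exists k => //; exists k; split.
  by move=> _ [l [l0 _ lb]]; exists l.
have mU : measurable (\bigcup_n E e n j) by exact: bigcup_measurable.
have cE : mu (E e n j) @[n --> \oo] --> mu (\bigcup_n E e n j).
  apply: nondecreasing_cvg_mu => // n m nm; apply/subsetPset => x [k [k0 kn kb]].
  by exists k; split => //; exact: leq_trans nm.
rewrite -(cvg_lim _ cE)//; apply: lime_le.
  by apply/cvg_ex; exists (mu (\bigcup_n E e n j)).
by apply: nearW => n; exact: maximal_inequality_fin.
Qed.

End maximal_inequality.

(** * The radial Julia set *)

Section radial_julia.
Variables (R : realType) (d : measure_display) (Omega : measurableType d).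
Variables (theta : Omega -> Omega) (eta : Omega -> R).
Local Notation iterF := (fiber_iter theta eta).

Definition bounded_times (N : nat) (x : Omega * cylinder R) : set nat :=
  [set i | `|cyl_Re (iterF i x.1 x.2)| <= N%:R].

(** Trades inverse branches for countably many conditions on real parts. Good times are bounded
    times; conversely a time [n] that is not good for large [N'] is unbounded itself or has [K + n]
    unbounded. *)
Lemma radial_juliaP (A B : R) : (expR 1)^-1 < A ->
  (forall omega, A <= eta omega <= B) ->
  forall x, radial_julia theta eta x <->
    forall e, exists N k0, forall k, (k0 <= k)%N ->
      (e.+1 * visits (~` bounded_times N x) k <= k)%N.
Proof.
move=> Ae etaAB x; split.
  move=> /cvgrPdist_lt H e.
  have e0 : 0 < e.+1%:R^-1 :> R by rewrite invr_gt0.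
  have [N _ /(_ N (leqnn N)) /=] := H _ e0.
  rewrite ltr_norml => /andP[_]; rewrite ltrBlDr -ltrBlDl => /lower_density_gt[k0 Hk].
  exists N, k0 => k /Hk Hv.
  have GS : good_times theta eta x.1 x.2 N `<=` bounded_times N x.
    by move=> i; exact: good_times_le.
  have /(congr1 (fun n => n%:R : R)) := visitsC (bounded_times N x) k.
  rewrite natrD => E.
  have : (visits (good_times theta eta x.1 x.2 N) k)%:R <=
      (visits (bounded_times N x) k)%:R :> R by rewrite ler_nat visitsS.
  move=> VV; rewrite -(ler_nat R) natrM -ler_pdivlMl ?ltr0Sn//.
  move: Hv; rewrite mulrBl mul1r -E; move: (_^-1 * _) => u Hv.
  by rewrite -(lerD2l (visits (bounded_times N x) k)%:R) -lerBlDr (le_trans Hv).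
move=> H; apply/cvgrPdist_lt => r r0.
(* The count of bad times is at most [(k + (K + k)) / e.+1], which is at most [3 k / e.+1] once
   [K <= k]. *)
pose e := Num.truncn (3 / r).
have er : 3 / e.+1%:R < r.
  by rewrite ltr_pdivrMr ?ltr0Sn// -ltr_pdivrMl// mulrC truncnS_gt.
have [N [k0 Hk]] := H e.
have [K [N0 HK]] := recurrent_good_times theta Ae etaAB N.
exists N0 => // N' /= N0N'.
set G := good_times _ _ _ _ _.
apply: le_lt_trans er; rewrite ger0_norm ?subr_ge0 ?lower_density_le1//.
rewrite lerBlDr -lerBlDl.
apply: (@lower_density_ge _ _ _ (maxn 1 (maxn k0 K))); last by rewrite leq_max.
move=> k; rewrite !geq_max => /and3P[k1 k0k Kk].
have GS : ~` G `<=` (~` bounded_times N x) `|`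
    [set i | (~` bounded_times N x) (K + i)%N].
  move=> i nG; apply: contrapT => /not_orP[/contrapT S1 /contrapT S2]; apply: nG.
  exact: HK.
have VG : (e.+1 * visits (~` G) k <= 3 * k)%N.
  apply: (@leq_trans (e.+1 * (visits (~` bounded_times N x) k
                              + visits (~` bounded_times N x) (K + k)))%N).
    rewrite leq_mul2l/= (leq_trans (visitsS _ GS))// (leq_trans (visits_subadd _ _ _))//.
    by rewrite leq_add2l visits_shift.
  rewrite mulnDr (leq_trans (leq_add (Hk k k0k) (Hk (K + k)%N _)))//.
    by rewrite (leq_trans k0k)// leq_addl.
  by lia.
have /(congr1 (fun n => n%:R : R)) := visitsC G k; rewrite natrD => E.
move: VG; rewrite -(ler_nat R) !natrM -ler_pdivlMl ?ltr0Sn// mulrA => VG.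
rewrite mulrBl mul1r [3 / _]mulrC -[X in X - _]E lerBlDr lerD2l.
by rewrite (le_trans VG).
Qed.

(** * Measurability of the radial Julia set *)

Hypothesis theta_meas : measurable_fun [set: Omega] theta.
Hypothesis eta_meas : measurable_fun [set: Omega] eta.

(** These three functions are independent of the lift, and their values after one step are
    measurable functions of [eta] and their previous values, so the induction closes. *)
Lemma measurable_fiber_iter_coord (n : nat) :
  [/\ measurable_fun setT (fun x : Omega * cylinder R => cyl_Re (iterF n x.1 x.2)),
      measurable_fun setT
        (fun x : Omega * cylinder R => cos (cyl_Im (iterF n x.1 x.2))) &
      measurable_fun setT
        (fun x : Omega * cylinder R => sin (cyl_Im (iterF n x.1 x.2)))].
Proof.
elim: n => [|n [IHre IHcos IHsin]] /=.
  split.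
  - exact: measurableT_comp (@measurable_cyl_Re R) measurable_snd.
  - exact: measurableT_comp (@measurable_cos_cyl_Im R) measurable_snd.
  - exact: measurableT_comp (@measurable_sin_cyl_Im R) measurable_snd.
have m_eta : measurable_fun setT (fun x : Omega * cylinder R => eta (iter n theta x.1)).
  apply: measurableT_comp => //; elim: n {IHre IHcos IHsin} => [|n IHn] /=.
    exact: measurable_fst.
  exact: measurableT_comp theta_meas IHn.
have m_exp : measurable_fun setT
    (fun x : Omega * cylinder R => expR (cyl_Re (iterF n x.1 x.2))).
  exact: measurableT_comp (@measurable_expR R) IHre.
have m_Re := measurable_funM m_eta (measurable_funM m_exp IHcos).
have m_Im := measurable_funM m_eta (measurable_funM m_exp IHsin).
rewrite /fiber_map; split.
- by apply: eq_measurable_fun m_Re => x _; rewrite cyl_map_coord cyl_Re_pi.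
- apply: eq_measurable_fun (measurableT_comp (continuous_measurable_fun
    (@continuous_cos R)) m_Im) => x _.
  by rewrite cyl_map_coord cos_cyl_Im_pi.
- apply: eq_measurable_fun (measurableT_comp (continuous_measurable_fun
    (@continuous_sin R)) m_Im) => x _.
  by rewrite cyl_map_coord sin_cyl_Im_pi.
Qed.

Lemma measurable_unbounded_times (N i : nat) :
  measurable [set x | (~` bounded_times N x) i].
Proof.
have [mRe _ _] := measurable_fiber_iter_coord i.
have -> : [set x | (~` bounded_times N x) i] =
    ~` ((fun x => `|cyl_Re (iterF i x.1 x.2)|) @^-1` `]-oo, N%:R]%classic).
  by apply/seteqP; split => x; rewrite /= in_itv /=.
apply: measurableC; rewrite -[X in measurable X]setTI.
exact: measurableT_comp (@normr_measurable R setT) mRe _ _ _.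
Qed.

Lemma fiber_iterSr (n : nat) (omega : Omega) (z : cylinder R) :
  iterF n.+1 omega z = iterF n (theta omega) (fiber_map eta omega z).
Proof. by elim: n => //= n ->; rewrite -iterSr. Qed.

Let good (e : nat) : set (Omega * cylinder R) :=
  [set x | exists N k0, forall k, (k0 <= k)%N ->
    (e.+1 * visits (~` bounded_times N x) k <= k)%N].

Let measurable_good e : measurable (good e).
Proof.
have -> : good e = \bigcup_N \bigcup_k0 \bigcap_(k in [set k | (k0 <= k)%N])
    ~` [set x | (k < e.+1 * visits (~` bounded_times N x) k)%N].
  apply/seteqP; split=> x.
    move=> [N [k0 Hk]]; exists N => //; exists k0 => // k /= /Hk.
    by rewrite leqNgt => /negP.
  by move=> [N _ [k0 _ Hk]]; exists N, k0 => k /Hk /= /negP; rewrite -leqNgt.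
apply: bigcup_measurable => N _; apply: bigcup_measurable => k0 _.
apply: bigcap_measurable => [|k _]; first by exists k0 => /=.
apply: measurableC.
exact: (@measurable_sum_visits _ _ R (fun i => [set x | (~` bounded_times N x) i])
  (measurable_unbounded_times N) e.+1 k 1 k.+1).
Qed.

(** * Full measure for invariant probabilities *)

Variable mu : probability (Omega * cylinder R)%type R.
Hypothesis mu_inv : forall E : set (Omega * cylinder R), measurable E ->
  pushforward mu (skew_map theta eta) E = mu E.

(** Outside [good e], for every [N] the orbit has an initial window with frequency of unbounded
    times above [1 / e.+1]. The maximal inequality bounds the measure by [e.+1 * mu (U N 0)], which
    tends to 0. *)
Let mu_goodC e : mu (~` good e) = 0%E.
Proof.
pose U N i := [set x | (~` bounded_times N x) i].
have UN N : (mu (~` good e) <= e.+1%:R%:E * mu (U N 0%N))%E.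
  have mU i : measurable (U N i) by exact: measurable_unbounded_times.
  have US i : U N i.+1 = skew_map theta eta @^-1` U N i.
    by apply/seteqP; split => x; rewrite /U /bounded_times /= -?fiber_iterSr.
  (* Windows start at 1 because [visits] counts from 1. *)
  apply: le_trans (maximal_inequality mU US mu_inv e.+1 1).
  apply: le_measure; rewrite ?inE; [exact: measurableC| |].
    have -> : [set x | exists k, (0 < k)%N /\
        (k < e.+1 * \sum_(1 <= i < 1 + k) `[< U N i x >])%N] =
      \bigcup_(k in [set k | (0 < k)%N])
          [set x | (k < e.+1 * \sum_(1 <= i < 1 + k) `[< U N i x >])%N].
      by apply/seteqP; split => x [k]; [move=> [k0 kb]|move=> k0 kb]; exists k.
    by apply: bigcup_measurable => k _; exact: measurable_sum_visits.
  (* Failure of the condition for this [N] with threshold 1 already yields a nonempty window of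
     excess. *)
  move=> x /= ng; apply: contrapT => nE; apply: ng; exists N, 1%N => k k0.
  by rewrite leqNgt; apply/negP => kb; apply: nE; exists k.
have U0 : mu (U N 0%N) @[N --> \oo] --> mu (\bigcap_N U N 0%N).
  apply: nonincreasing_cvg_mu.
  - by rewrite ltey_eq fin_num_measure//; exact: measurable_unbounded_times.
  - by move=> N; exact: measurable_unbounded_times.
  - by apply: bigcapT_measurable => N; exact: measurable_unbounded_times.
  - move=> N M NM; apply/subsetPset => x; apply: contra_not.
    by rewrite /bounded_times /= => /le_trans; apply; rewrite ler_nat.
(* Every point has a finite real part, so it leaves [U N 0] for large [N]. *)
have cap0 : \bigcap_N U N 0%N = set0.
  rewrite -subset0 => x /(_ (Num.truncn `|cyl_Re x.2|).+1 I); apply.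
  by rewrite /bounded_times /= ltW// truncnS_gt.
rewrite cap0 measure0 in U0.
have L0 := @cvgeZl _ _ _ _ _ _ (isT : e.+1%:R%:E \is a fin_num) U0.
apply/eqP; rewrite eq_le measure_ge0 andbT -(mule0 e.+1%:R%:E) -(cvg_lim _ L0)//.
apply: lime_ge; first by apply/cvg_ex; eexists; exact: L0.
by apply: nearW => N; exact: UN.
Qed.

Lemma radial_julia_full (A B : R) : (expR 1)^-1 < A ->
  (forall omega, A <= eta omega <= B) ->
  measurable (radial_julia theta eta) /\ mu (radial_julia theta eta) = 1%E.
Proof.
move=> Ae etaAB.
have -> : radial_julia theta eta = \bigcap_e good e.
  apply/seteqP; split => x.
    by move=> /(radial_juliaP Ae etaAB) H e _; exact: H.
  by move=> H; apply/(radial_juliaP Ae etaAB) => e; exact: H.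
have mJ : measurable (\bigcap_e good e) by exact: bigcapT_measurable.
split => //; rewrite -[X in mu X]setCK probability_setC; last exact: measurableC.
rewrite (_ : mu _ = 0%E) ?sube0//; apply/eqP; rewrite eq_le measure_ge0 andbT.
have /negligibleP N0 : mu.-negligible (~` \bigcap_e good e).
  rewrite setC_bigcap; apply: negligible_bigcup => e.
  by apply/negligibleP; [exact: measurableC|exact: mu_goodC].
by rewrite N0//; exact: measurableC.
Qed.

End radial_julia.

Theorem proposition55 (R : realType) (d : measure_display)
    (Omega : measurableType d) (m : probability Omega R)
    (theta theta_inv : Omega -> Omega) (A B : R) (eta : Omega -> R)
    (m_complete : measure_is_complete m)
    (theta_invK : cancel theta theta_inv)
    (thetaK : cancel theta_inv theta)
    (theta_meas : measurable_fun [set: Omega] theta)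
    (theta_inv_meas : measurable_fun [set: Omega] theta_inv)
    (theta_pres : measure_preserving m theta)
    (theta_erg : ergodic m theta)
    (A_gt : (expR 1)^-1 < A) (AB : A < B)
    (eta_meas : measurable_fun [set: Omega] eta)
    (eta_bnd : forall omega, A <= eta omega <= B)
    (mu : probability (Omega * cylinder R)%type R)
    (mu_marginal : forall E : set Omega, measurable E ->
       pushforward mu (@fst Omega (cylinder R)) E = m E)
    (mu_inv : forall E : set (Omega * cylinder R), measurable E ->
       pushforward mu (skew_map theta eta) E = mu E) :
  measurable (radial_julia theta eta) /\ mu (radial_julia theta eta) = 1%E.
Proof. exact: radial_julia_full A_gt eta_bnd. Qed.
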